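(* Let $U_1,\ldots,U_n$ form a non-periodic collection of commuting invertible measure preserving transformations on a non-atomic probability space $(\Omega,\Sigma,\mu)$ and, for $0<\alpha<1$, let $C_S^\ast(\alpha)$ and $\tilde{C}_S(\alpha)$ be the Tauberian constants associated with the strong ergodic maximal operator $M_S^\ast$ of $U_1,\ldots,U_n$ and the discrete strong maximal operator $\tilde{M}_S$ on $\mathbb{Z}^n$, respectively. Then $$C_S^\ast(\alpha)=\tilde{C}_S(\alpha).$$
   Context: Non-periodicity: a collection $U_1,\ldots,U_n$ of commuting invertible measure preserving transformations is non-periodic if for every $(\ell_1,\ldots,\ell_n)\in\mathbb{Z}^n\setminus\{0\}$ we have $\mu(\{x\in\Omega: U_1^{\ell_1}\cdots U_n^{\ell_n}x=x\})=0$. In the following, suprema over $R$ are over all open rectangular parallelepipeds $R\subset\mathbb{R}^n$ with sides parallel to the coordinate axes that contain the origin; $\chi_E$ is the indicator function of $E$ and $\#$ denotes cardinality. Strong ergodic maximal operator: for $\omega\in\Omega$, $$M_S^\ast f(\omega)=\sup_{R\ni 0}\frac{1}{\#(R\cap\mathbb{Z}^n)}\sum_{(j_1,\ldots,j_n)\in R\cap\mathbb{Z}^n}|f(U_1^{j_1}\cdots U_n^{j_n}\omega)|,\qquad C_S^\ast(\alpha)=\sup_{E\in\Sigma,\ \mu(E)>0}\frac{1}{\mu(E)}\mu(\{\omega\in\Omega: M_S^\ast\chi_E(\omega)>\alpha\}).$$ Discrete strong maximal operator: for $m\in\mathbb{Z}^n$, $$\tilde{M}_Sf(m)=\sup_{R\ni0}\frac{1}{\#(R\cap\mathbb{Z}^n)}\sum_{j\in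 R\cap\mathbb{Z}^n}|f(m+j)|,\qquad \tilde{C}_S(\alpha)=\sup_{E\subset\mathbb{Z}^n,\ 0<\#E<\infty}\frac{1}{\#E}\#\{m\in\mathbb{Z}^n: \tilde{M}_S\chi_E(m)>\alpha\}.$$
   Formalization: The probability space is additionally assumed to have countably many measurable sets separating points off a null set (true for all Lebesgue or standard Borel spaces); for arbitrary non-atomic probability spaces the claim fails. *)

(* Defs.v *)
From HB Require Import structures.
From mathcomp Require Import all_boot all_order all_algebra finmap.
From mathcomp Require Import all_classical all_reals all_analysis.

Set Implicit Arguments.
Unset Strict Implicit.
Unset Printing Implicit Defensive.

Import Order.TTheory GRing.Theory Num.Theory.

Local Open Scope classical_set_scope.
Local Open Scope ring_scope.

Section Transformations.
Context d (T : measurableType d) (R : realType).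
Variable mu : set T -> \bar R.

Record mp_transf := MPTransf {
  mpt_fun :> T -> T;
  mpt_inv : T -> T;
  mpt_funK : cancel mpt_fun mpt_inv;
  mpt_invK : cancel mpt_inv mpt_fun;
  mpt_measurable : measurable_fun setT mpt_fun;
  mpt_inv_measurable : measurable_fun setT mpt_inv;
  mpt_preserving : forall A, measurable A -> mu (mpt_fun @^-1` A) = mu A }.

Definition mpt_pow (V : mp_transf) (k : int) : T -> T :=
  match k with
  | Posz p => iter p V
  | Negz p => iter p.+1 (mpt_inv V)
  end.

(* U_1^{l_1} ... U_n^{l_n}, the rightmost factor being applied first *)
Definition mpt_act n (U : 'I_n -> mp_transf) (l : 'rV[int]_n) : T -> T :=
  \big[comp/idfun]_(i < n) mpt_pow (U i) (l 0 i).

Definition commuting n (U : 'I_n -> mp_transf) : Prop :=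
  forall (i j : 'I_n) (x : T), U i (U j x) = U j (U i x).

(* Library measures take arbitrary values on non-measurable sets, so "measure
   zero" is expressed as being contained in a measurable null set. *)
Definition non_periodic n (U : 'I_n -> mp_transf) : Prop :=
  forall l : 'rV[int]_n, l != 0 ->
    mu.-negligible [set x | mpt_act U l x = x].

Definition non_atomic : Prop :=
  forall A, measurable A -> (0 < mu A)%E ->
    exists B, [/\ measurable B, B `<=` A, (0 < mu B)%E & (mu B < mu A)%E].

(* Off a null set, countably many measurable sets separate points.  Every
   Lebesgue space and every probability on a standard Borel space has this
   property.  Without it a pointwise condition such as non_periodic says nothing
   about how the transformations act on measurable sets: U may move every point
   and still map each measurable set to itself. *)
Definition countably_separated : Prop :=
  exists (B : nat -> set T) (N : set T),
    [/\ forall k, measurable (B k),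
        mu.-negligible N
      & forall x y, ~ N x -> ~ N y -> (forall k, B k x <-> B k y) -> x = y].

End Transformations.

Section StrongAverages.
Context (R : realType) (n : nat).

Definition open_rect (a b : 'rV[R]_n) : set 'rV[R]_n :=
  [set x | forall i, a 0 i < x 0 i < b 0 i].

Definition rects0 : set (set 'rV[R]_n) :=
  [set Q | (exists a b, Q = open_rect a b) /\ Q 0].

Definition lattice_pts (Q : set 'rV[R]_n) : set 'rV[int]_n :=
  [set j | Q (map_mx intr j)].

Definition lattice_avg (Q : set 'rV[R]_n) (g : 'rV[int]_n -> R) : R :=
  (#|` fset_set (lattice_pts Q)|%:R)^-1 * \sum_(j \in lattice_pts Q) `|g j|.

Definition strong_sup (g : 'rV[int]_n -> R) : \bar R :=
  ereal_sup [set (lattice_avg Q g)%:E | Q in rects0].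

Definition discrete_strong_max (f : 'rV[int]_n -> R) (m : 'rV[int]_n) : \bar R :=
  strong_sup (fun j => f (m + j)).

Definition discrete_tauberian (alpha : R) : \bar R :=
  ereal_sup [set ((counting E)^-1 *
      counting [set m | alpha%:E < discrete_strong_max \1_E m])%E
    | E in [set E : set 'rV[int]_n | finite_set E /\ E !=set0]].

End StrongAverages.

Section ErgodicMaximal.
Context d (T : measurableType d) (R : realType) (mu : set T -> \bar R).
Context (n : nat) (U : 'I_n -> mp_transf mu).

Definition ergodic_strong_max (f : T -> R) (w : T) : \bar R :=
  strong_sup (fun j : 'rV[int]_n => f (mpt_act U j w)).

Definition ergodic_tauberian (alpha : R) : \bar R :=
  ereal_sup [set ((mu E)^-1 *
      mu [set w | alpha%:E < ergodic_strong_max \1_E w])%E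
    | E in [set E : set T | measurable E /\ (0 < mu E)%E]].

End ErgodicMaximal.

(* Main.v *)
Require Import Defs.
From mathcomp Require Import all_boot all_order all_algebra finmap.
From mathcomp Require Import all_classical all_reals all_analysis.
From mathcomp Require Import measurable_realfun zify lra.
Import Order.TTheory GRing.Theory Num.Theory.
Import numFieldNormedType.Exports.
Local Open Scope classical_set_scope.
Local Open Scope ring_scope.

(* [<=] is a transference argument: let A_N collect the points at which some
   rectangle contained in [-N, N]^n has average > alpha.  Along each orbit, the
   visits to A_N during [-K, K]^n lie in a superlevel set of the discrete
   maximal function of the visits to E during [-(K + N), K + N]^n.  Counting,
   integrating and letting K, then N, tend to infinity gives the inequality.
   [>=] copies a finite configuration of Z^n into Omega along disjoint
   translates of a set B of positive measure; these need not fill Omega, so no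
   Rokhlin tower is required.  Such a B exists because, by countable separation
   and non-periodicity, almost every x is separated from U^l x by one of
   countably many measurable sets, so that any set of positive measure has a
   subset of positive measure that is disjoint from its preimage under U^l. *)

(** * Measure preservation and the group law of the action of Z^n *)

Section Action.
Set Implicit Arguments.
Unset Strict Implicit.
Context d (T : measurableType d) (R : realType) (mu : {measure set T -> \bar R}).

Definition measure_preserving (f : T -> T) : Prop :=
  measurable_fun setT f /\ forall A, measurable A -> mu (f @^-1` A) = mu A.

Lemma measure_preserving_id : measure_preserving idfun.
Proof. by split => //; exact: measurable_id. Qed.

Lemma measure_preserving_comp (f g : T -> T) :
  measure_preserving f -> measure_preserving g -> measure_preserving (f \o g).
Proof.
move=> [mf pf] [mg pg]; split; first exact: measurableT_comp.
move=> A mA; rewrite comp_preimage pg ?pf //.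
by rewrite -[_ @^-1` _]setTI; exact: mf.
Qed.

Lemma measure_preserving_iter (f : T -> T) p :
  measure_preserving f -> measure_preserving (iter p f).
Proof.
move=> hf; elim: p => [|p IHp]; first exact: measure_preserving_id.
exact: (measure_preserving_comp hf IHp).
Qed.

Lemma mpt_inv_preserving (V : mp_transf mu) : measure_preserving (mpt_inv V).
Proof.
split; first exact: mpt_inv_measurable.
move=> A mA; rewrite -(mpt_preserving V (A := mpt_inv V @^-1` A)).
  by congr (mu _); apply/seteqP; split=> x /=; rewrite mpt_funK.
by rewrite -[_ @^-1` _]setTI; exact: mpt_inv_measurable.
Qed.

Lemma mpt_pow_preserving (V : mp_transf mu) k : measure_preserving (mpt_pow V k).
Proof.
case: k => p; last exact: measure_preserving_iter (mpt_inv_preserving V).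
by apply: measure_preserving_iter; split;
  [exact: mpt_measurable | exact: mpt_preserving].
Qed.

Lemma mpt_pow_succ (V : mp_transf mu) k x : mpt_pow V (k + 1) x = V (mpt_pow V k x).
Proof.
case: k => p; first by rewrite -PoszD addn1.
(* [Negz p] is -(p+1), so its successor is -p; for p = 0 this falls into the [Posz] branch of
   [mpt_pow]. *)
have -> : Negz p + 1 = - p%:Z by rewrite NegzE; lia.
by case: p => [|p] /=; rewrite mpt_invK.
Qed.

Lemma mpt_pow_pred (V : mp_transf mu) k x :
  mpt_pow V (k - 1) x = mpt_inv V (mpt_pow V k x).
Proof. by rewrite -[in RHS](subrK 1 k) mpt_pow_succ mpt_funK. Qed.

Lemma mpt_powD (V : mp_transf mu) a b x :
  mpt_pow V (a + b) x = mpt_pow V a (mpt_pow V b x).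
Proof.
elim: a => [|p IHp|p IHp]; first by rewrite add0r.
- by rewrite -addn1 PoszD addrAC !mpt_pow_succ IHp.
- have -> : - p.+1%:Z = - p%:Z - 1 by lia.
  by rewrite addrAC !mpt_pow_pred IHp.
Qed.

Lemma mpt_pow_comm (V : mp_transf mu) (g : T -> T) k :
  (forall x, V (g x) = g (V x)) ->
  forall x, mpt_pow V k (g x) = g (mpt_pow V k x).
Proof.
move=> Vg x; elim: k => [//|p IHp|p IHp].
- by rewrite -addn1 PoszD !mpt_pow_succ IHp.
- have -> : - p.+1%:Z = - p%:Z - 1 by lia.
  by rewrite !mpt_pow_pred IHp -[in LHS](mpt_invK V (mpt_pow V _ x)) -Vg mpt_funK.
Qed.

Lemma big_comp_comm (I : Type) (r : seq I) (f : I -> T -> T) (g : T -> T) :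
  (forall i x, f i (g x) = g (f i x)) ->
  forall x, (\big[comp/idfun]_(i <- r) f i) (g x) =
            g ((\big[comp/idfun]_(i <- r) f i) x).
Proof.
move=> fg; elim: r => [|i r IHr] x; first by rewrite big_nil.
by rewrite big_cons /= IHr fg.
Qed.

(** Composition is not commutative, so each [g i] has to be moved past the product of the remaining
    factors [f j]. *)
Lemma big_comp_split (I : Type) (r : seq I) (f g : I -> T -> T) :
  (forall i j x, f i (g j x) = g j (f i x)) ->
  forall x, (\big[comp/idfun]_(i <- r) (f i \o g i)) x =
    (\big[comp/idfun]_(i <- r) f i) ((\big[comp/idfun]_(i <- r) g i) x).
Proof.
move=> fg; elim: r => [|i r IHr] x; first by rewrite !big_nil.
by rewrite !big_cons /= IHr (@big_comp_comm _ r f (g i)).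
Qed.

Context (n : nat) (U : 'I_n -> mp_transf mu).

Lemma mpt_act_preserving l : measure_preserving (mpt_act U l).
Proof.
rewrite /mpt_act; elim/big_ind: _ => [|f g|i _].
- exact: measure_preserving_id.
- exact: measure_preserving_comp.
- exact: mpt_pow_preserving.
Qed.

Lemma measurable_act_preimage l A : measurable A -> measurable (mpt_act U l @^-1` A).
Proof.
move=> mA; rewrite -[_ @^-1` _]setTI.
by have [mf _] := mpt_act_preserving l; exact: mf.
Qed.

Lemma mpt_actD (hcomm : commuting U) l m x :
  mpt_act U (l + m) x = mpt_act U l (mpt_act U m x).
Proof.
rewrite /mpt_act -big_comp_split; last first.
  move=> i j y; apply: mpt_pow_comm => z.
  by rewrite (mpt_pow_comm (g := U i)).
apply: (congr1 (@^~ x)); apply: eq_bigr => i _.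
by apply/funext => y; rewrite mxE /= mpt_powD.
Qed.

End Action.

(** * Cubes, traces of rectangles on Z^n, and the discrete Tauberian bound *)

Section Lattice.
Set Implicit Arguments.
Unset Strict Implicit.
Context (n : nat).

(** The shift by [N] parametrizes [-N, N]^n injectively by a finite function space, whose
    cardinality is known. *)
Definition cube_pt N (f : {ffun 'I_n -> 'I_(2 * N).+1}) : 'rV[int]_n :=
  \row_i ((f i)%:Z - N%:Z).

Definition cube N : {fset 'rV[int]_n} :=
  [fset @cube_pt N f | f in {ffun 'I_n -> 'I_(2 * N).+1}]%fset.

Lemma card_cube N : #|` cube N| = ((2 * N).+1 ^ n)%N.
Proof.
rewrite card_imfset /=; last first.
  move=> f g /rowP fg; apply/ffunP => i; apply/val_inj => /=.
  by have := fg i; rewrite !mxE => /addIr [].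
by rewrite -cardE card_ffun !card_ord.
Qed.

Lemma mem_cubeP N (l : 'rV[int]_n) :
  reflect (forall i, `|l 0 i| <= N%:Z) (l \in cube N).
Proof.
apply: (iffP (imfsetP _ _ _ _)) => [[f _ ->] i|lN].
  rewrite mxE ler_norml; by move: (nat_of_ord (f i)) (ltn_ord (f i)) => k; lia.
exists [ffun i => inord (absz (l 0 i + N%:Z))] => //.
apply/rowP => i; rewrite mxE ffunE inordK; move: (l 0 i) (lN i) => z; lia.
Qed.

Lemma cubeD N M (l m : 'rV[int]_n) :
  l \in cube N -> m \in cube M -> l + m \in cube (N + M).
Proof.
move=> /mem_cubeP hl /mem_cubeP hm; apply/mem_cubeP => i.
by rewrite mxE; move: (l 0 i) (m 0 i) (hl i) (hm i) => x y; lia.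
Qed.

Lemma cube_exhaust (l : 'rV[int]_n) : exists N, l \in cube N.
Proof.
exists (\sum_i absz (l ord0 i))%N; apply/mem_cubeP => i.
by rewrite (bigD1 i) //=; move: (l 0 i) (\sum_(_ | _) _)%N => x y; lia.
Qed.

Lemma cube_homo N M : (N <= M)%N -> (cube N `<=` cube M)%fset.
Proof.
move=> NM; apply/fsubsetP => l /mem_cubeP hl; apply/mem_cubeP => i.
by move: (l 0 i) (hl i) => x; lia.
Qed.

Lemma fset_sub_cube (L : {fset 'rV[int]_n}) : exists N, (L `<=` cube N)%fset.
Proof.
have [N hN] := choice cube_exhaust.
exists (\sum_(l <- L) N l)%N; apply/fsubsetP => l lL.
apply: (fsubsetP (cube_homo _)) (hN l).
by rewrite (big_fsetD1 l) //= leq_addr.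
Qed.

Context (R : realType).

(** [fset_set] is empty on infinite sets, so finiteness is what makes [lattice_avg] a genuine
    average. The enclosing cube is read off the corners of the rectangle. *)
Lemma finite_lattice_pts (Q : set 'rV[R]_n) :
  rects0 Q -> finite_set (lattice_pts Q).
Proof.
move=> [[a [b ->]] _].
pose N := (\sum_i Num.bound (`|a ord0 i| + `|b ord0 i|)%R)%N.
apply: (@sub_finite_set _ _ [set` cube N]); last exact: finite_fset.
move=> j /= jab; apply/mem_cubeP => i; have := jab i; rewrite mxE => hi.
have := archi_boundP (addr_ge0 (normr_ge0 (a 0 i)) (normr_ge0 (b 0 i))).
have : (Num.bound (`|a 0 i| + `|b 0 i|))%:R <= N%:R :> R.
  by rewrite ler_nat /N (bigD1 i) //= leq_addr.
move=> h1 h2; rewrite -(ler_int R) intr_norm -pmulrn.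
have := ler_norm (b 0 i); have := ler_norm (- a 0 i); rewrite normrN.
have := normr_ge0 (a 0 i); have := normr_ge0 (b 0 i).
by rewrite ler_norml; lra.
Qed.

(** An average depends only on the lattice trace of its rectangle. Traces are finite sets, hence
    countably many, although the rectangles are not. *)
Definition lattice_rect (L : {fset 'rV[int]_n}) : Prop :=
  exists2 Q : set 'rV[R]_n, rects0 Q & lattice_pts Q = [set` L].

Definition fset_avg (L : {fset 'rV[int]_n}) (g : 'rV[int]_n -> R) : R :=
  (#|` L|%:R)^-1 * \sum_(j <- L) `|g j|.

Lemma strong_sup_gtP (x : R) (g : 'rV[int]_n -> R) :
  (x%:E < strong_sup g)%E <-> exists2 L, lattice_rect L & x < fset_avg L g.
Proof.
split=> [/ereal_sup_gt [_ [Q Q0 <-]]|[L [Q Q0 QL]] xL].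
- rewrite lte_fin /lattice_avg => xQ; have fQ := finite_lattice_pts Q0.
  exists (fset_set (lattice_pts Q)); first by exists Q; rewrite ?fset_setK.
  by rewrite /fset_avg -fsbig_finite.
- apply: (@lt_le_trans _ _ (fset_avg L g)%:E); first by rewrite lte_fin.
  apply: ereal_sup_ubound; exists Q => //; congr (_%:E).
  by rewrite /lattice_avg fsbig_finite ?QL ?set_fsetK //; exact: finite_fset.
Qed.

Lemma fset_avg_indic_le (L : {fset 'rV[int]_n}) (S T : Type) (A : set S) (B : set T) f g :
  (forall j, j \in L -> A (f j) -> B (g j)) ->
  fset_avg L (fun j => \1_A (f j)) <= fset_avg L (fun j => \1_B (g j)) :> R.
Proof.
move=> AB; rewrite ler_wpM2l ?invr_ge0 // big_seq [leRHS]big_seq.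
apply: ler_sum => j jL; rewrite !indicE !normr_nat ler_nat.
case: (boolP (f j \in A)) => // /set_mem Afj.
by rewrite mem_set //; exact: AB.
Qed.

(** For fixed [N], the ratio of the cardinalities of [cube (K + N)] and [cube K] tends to 1 as [K]
    grows. *)
Lemma le_of_cube_growth (x y : R) N : 0 <= y ->
  (forall K, (#|` cube K|%:R * x <= #|` cube (K + N)|%:R * y)) -> x <= y.
Proof.
move=> y0 hK.
have xr t : x <= (1 + harmonic t) ^+ n * y.
  (* With this [K] the side ratio 1 + 2N/(2K+1) is at most 1 + 1/(t+1). *)
  pose K := (N * t.+1)%N.
  have K0 : 0 < (2 * K).+1%:R :> R by [].
  rewrite -(ler_pM2l (exprn_gt0 n K0)).
  have := hK K; rewrite !card_cube !natrX => /le_trans; apply.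
  rewrite mulrA -exprMn ler_wpM2r // lerXn2r ?nnegrE ?mulr_ge0 ?addr_ge0 ?harmonic_ge0 //.
  rewrite mulrDr mulr1 -lerBlDl /harmonic ler_pdivlMr //.
  have -> : (2 * (K + N)).+1%:R - (2 * K).+1%:R = (2 * N)%:R :> R.
    by rewrite -natrB; [congr _%:R; lia | lia].
  by rewrite -natrM ler_nat /K; lia.
have cv : (1 + harmonic t) ^+ n * y @[t --> \oo] --> (1 ^+ n * y : R).
  have h : 1 + harmonic t @[t --> \oo] --> (1 : R).
    by rewrite -[X in _ --> X]addr0; apply: cvgD; [exact: cvg_cst | exact: cvg_harmonic].
  exact: cvgM (continuous_cvg _ (@exprn_continuous R n 1) h) (cvg_cst _).
rewrite expr1n mul1r in cv; rewrite -(cvg_lim _ cv) //.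
apply: limr_ge; first by apply/cvg_ex; exists y.
exact: nearW.
Qed.

(** Finite form of the Tauberian inequality: [X] may be any finite part of the superlevel set of the
    indicator of [F]. *)
Lemma discrete_tauberian_fset_le (alpha c : R) (F X : {fset 'rV[int]_n}) :
  0 < alpha -> discrete_tauberian n alpha = c%:E ->
  (forall m, m \in X -> exists2 L, lattice_rect L &
    alpha < fset_avg L (fun j => \1_[set` F] (m + j))) ->
  #|` X|%:R <= c * #|` F|%:R.
Proof.
move=> alpha0 cE Xalpha; have [F0|F0] := eqVneq F fset0.
  have -> : X = fset0.
    apply/eqP; rewrite -fsubset0; apply/fsubsetP => m /Xalpha[L _].
    rewrite /fset_avg big1 ?mulr0 ?ltNge ?(ltW alpha0) // => j _.
    by rewrite F0 indicE memNset ?normr0 //= inE.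
  by rewrite F0 cardfs0 mulr0.
have kF : 0 < #|` F|%:R :> R by rewrite ltr0n cardfs_gt0.
have cF : ((counting [set` F])^-1 *
    counting [set m | alpha%:E < discrete_strong_max \1_[set` F] m] <= c%:E)%E.
  rewrite -cE; apply: ereal_sup_ubound; exists [set` F] => //.
  by split; [exact: finite_fset | have /fset0Pn := F0].
have kE : counting [set` F] = #|` F|%:R%:E :> \bar R.
  by rewrite /counting asboolT ?set_fsetK //; exact: finite_fset.
rewrite kE inver gt_eqF // lee_pdivrMl // in cF.
rewrite -lee_fin mulrC EFinM; apply: le_trans cF.
rewrite /counting; case: asboolP => [finH|_]; last by rewrite leey.
rewrite lee_fin ler_nat; apply: fsubset_leq_card; apply/fsubsetP => m mX.
by rewrite in_fset_set // mem_set //=; apply/strong_sup_gtP; exact: Xalpha.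
Qed.

End Lattice.

(** * Sets of positive measure disjoint from their translates *)

Section DisjointTranslates.
Set Implicit Arguments.
Unset Strict Implicit.
Context d (T : measurableType d) (R : realType) (mu : {measure set T -> \bar R}).

Lemma negligible_preimage (f : T -> T) N :
  measure_preserving mu f -> mu.-negligible N -> mu.-negligible (f @^-1` N).
Proof.
move=> [mf pf] [M [mM M0 NM]]; exists (f @^-1` M); split.
- by rewrite -[_ @^-1` _]setTI; exact: mf.
- by rewrite pf.
- by move=> x; exact: NM.
Qed.

Lemma disjoint_preimage_subset (f : T -> T) A :
  countably_separated mu -> measure_preserving mu f ->
  mu.-negligible [set x | f x = x] -> measurable A -> (0 < mu A)%E ->
  exists B, [/\ measurable B, B `<=` A, (0 < mu B)%E & B `&` f @^-1` B = set0].
Proof.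
move=> [S [N [mS N0 sepS]]] hf fix0 mA A0.
have mfS k : measurable (f @^-1` S k).
  by rewrite -[_ @^-1` _]setTI; exact: hf.1.
(* [F k] and [G k] hold the points of [A] that [S k] separates from their image, one for each
   direction, so each is disjoint from its own preimage. If all of them are null, almost every point
   of [A] is fixed by [f]. *)
pose F k := A `&` (S k `\` f @^-1` S k).
pose G k := A `&` (f @^-1` S k `\` S k).
have mF k : measurable (F k) by apply: measurableI => //; exact: measurableD.
have mG k : measurable (G k) by apply: measurableI => //; exact: measurableD.
have [[k Fk]|nF] := pselect (exists k, (0 < mu (F k))%E).
  exists (F k); split=> //; first exact: subIsetl.
  by apply/seteqP; split=> // x [[_ [_ nSfx]] [_ [Sfx _]]].
have [[k Gk]|nG] := pselect (exists k, (0 < mu (G k))%E).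
  exists (G k); split=> //; first exact: subIsetl.
  by apply/seteqP; split=> // x [[_ [Sfx _]] [_ [_ nSfx]]].
have F0 k : mu.-negligible (F k).
  apply/negligibleP => //; apply/eqP; rewrite eq_le measure_ge0 andbT leNgt.
  by apply/negP => h; apply: nF; exists k.
have G0 k : mu.-negligible (G k).
  apply/negligibleP => //; apply/eqP; rewrite eq_le measure_ge0 andbT leNgt.
  by apply/negP => h; apply: nG; exists k.
suff /negligibleP -/(_ mA) muA0 : mu.-negligible A by rewrite muA0 ltxx in A0.
apply: negligibleS (negligibleU (negligibleU N0 (negligible_preimage hf N0))
  (negligibleU fix0 (negligibleU (negligible_bigcup F0) (negligible_bigcup G0)))).
move=> x Ax; apply: contrapT => /not_orP[/not_orP[nNx nNfx]].
move=> /not_orP[nfix /not_orP[nFx nGx]]; apply: nfix => /=.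
apply: sepS => // k; split=> [Sfx|Sx]; apply: contrapT => nS.
- by apply: nGx; exists k.
- by apply: nFx; exists k.
Qed.

(** The vectors of [s] are treated one at a time: shrinking the set preserves the disjointness
    already obtained. *)
Lemma disjoint_translates_set (n : nat) (U : 'I_n -> mp_transf mu)
    (s : seq 'rV[int]_n) A :
  countably_separated mu -> non_periodic U -> all (fun l => l != 0) s ->
  measurable A -> (0 < mu A)%E ->
  exists B, [/\ measurable B, (0 < mu B)%E &
    forall l, l \in s -> B `&` mpt_act U l @^-1` B = set0].
Proof.
move=> hsep hnp; elim: s => [|l s IHs] /=; first by exists A.
move=> /andP[l0 s0] mA A0; have [B [mB B0 sB]] := IHs s0 mA A0.
have [C [mC CB C0 Cl]] := disjoint_preimage_subset hsep
  (mpt_act_preserving U l) (hnp _ l0) mB B0.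
exists C; split=> // m; rewrite inE => /orP[/eqP-> //|ms].
apply/seteqP; split=> // x [Cx Cmx]; rewrite -(sB m ms).
by split; exact: CB.
Qed.

End DisjointTranslates.

(** * Measurability of the superlevel sets of the ergodic maximal function *)

Section Superlevel.
Set Implicit Arguments.
Unset Strict Implicit.
Context d (T : measurableType d) (R : realType) (mu : {measure set T -> \bar R}).
Context (n : nat) (U : 'I_n -> mp_transf mu) (alpha : R).

Definition avg_superlevel (E : set T) (L : {fset 'rV[int]_n}) : set T :=
  [set w | alpha < fset_avg L (fun j => \1_E (mpt_act U j w))].

Lemma measurable_avg_superlevel E L :
  measurable E -> measurable (avg_superlevel E L).
Proof.
move=> mE; pose f w : R := fset_avg L (fun j => \1_E (mpt_act U j w)).
have mf : measurable_fun setT f.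
  apply: measurable_funM; first exact: measurable_cst.
  apply: measurable_sum => j.
  have mj : measurable_fun setT (\1_(mpt_act U j @^-1` E) : T -> R).
    by apply: measurable_indic; exact: measurable_act_preimage.
  exact: (measurableT_comp (@normr_measurable R setT) mj).
have := measurable_fun_ltr (measurable_cst alpha) mf.
move=> /(_ measurableT [set true] I); rewrite setTI.
by congr measurable; apply/seteqP; split.
Qed.

(** The finite subsets of Z^n form a countable type, so any union indexed by them is countable. *)
Lemma measurable_bigcup_fset (P : set {fset 'rV[int]_n})
    (F : {fset 'rV[int]_n} -> set T) :
  (forall L, measurable (F L)) -> measurable (\bigcup_(L in P) F L).
Proof.
move=> mF; rewrite bigcup_mkcond; apply: countable_bigcupT_measurable.
  exact: countableP.
by move=> L; case: ifP.
Qed.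

Lemma ergodic_superlevelE E :
  [set w | (alpha%:E < ergodic_strong_max U \1_E w)%E] =
  \bigcup_(L in @lattice_rect n R) avg_superlevel E L.
Proof.
apply/seteqP; split=> w /=.
- by move=> /strong_sup_gtP [L rL Lw]; exists L.
- by move=> [L rL Lw]; apply/strong_sup_gtP; exists L.
Qed.

Lemma measurable_ergodic_superlevel E : measurable E ->
  measurable [set w | (alpha%:E < ergodic_strong_max U \1_E w)%E].
Proof.
move=> mE; rewrite ergodic_superlevelE; apply: measurable_bigcup_fset => L.
exact: measurable_avg_superlevel.
Qed.

End Superlevel.

(** * Bounding the counting measure through finite subsets *)

Section CountingBound.
Set Implicit Arguments.
Unset Strict Implicit.
Context (R : realType).

(** An infinite [A] has finite parts of arbitrarily large cardinality, which forces [c] to be +oo.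
    Finiteness of [A] need not be known beforehand. *)
Lemma counting_fset_le (T : choiceType) (A : set T) (c : \bar R) :
  (forall X : {fset T}, [set` X] `<=` A -> (#|` X|%:R%:E <= c)%E) ->
  (counting A <= c)%E.
Proof.
move=> Ac; rewrite /counting; case: ifPn => [/asboolP finA|/asboolPn infA].
  by apply: Ac; rewrite fset_setK.
have c0 : (0 <= c)%E by have := Ac fset0; rewrite cardfs0; apply=> x /=; rewrite inE.
case: c c0 Ac => [r r0|//|//] Ac.
have [X XA kX] := infinite_set_fset (Num.bound r) infA.
have := Ac X XA; rewrite lee_fin leNgt => /negP; case.
by rewrite (lt_le_trans (archi_boundP r0)) // ler_nat.
Qed.

End CountingBound.

(** * Lower bound for the ergodic constant: copying configurations of Z^n into the space *)

Section Comparison.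
Set Implicit Arguments.
Unset Strict Implicit.
Context (R : realType) d (T : measurableType d) (mu : probability T R).
Context (n : nat) (U : 'I_n -> mp_transf mu) (alpha : R).

Lemma discrete_tauberian_le_ergodic :
  commuting U -> countably_separated mu -> non_periodic U ->
  (discrete_tauberian n alpha <= ergodic_tauberian U alpha)%E.
Proof.
move=> hcomm hsep hnp; apply: ge_ereal_sup => _ [E [finE [e0 Ee0]] <-].
set H := [set m | _]; set C := ergodic_tauberian U alpha.
pose k := #|` fset_set E|.
have k0 : 0 < k%:R :> R.
  rewrite ltr0n cardfs_gt0; apply/fset0Pn; exists e0.
  by rewrite in_fset_set // mem_set.
have -> : counting E = k%:R%:E :> \bar R by rewrite /counting asboolT.
rewrite inver gt_eqF // lee_pdivrMl //; apply: counting_fset_le => X XH.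
(* [W] contains every index whose translate of [B] is used; its nonzero differences are the shifts
   that [B] must avoid. *)
pose W := (fset_set E `|` X)%fset.
have T0 : (0 < mu setT)%E by rewrite probability_setT lte01.
have [B [mB B0 hB]] := disjoint_translates_set
  (s := [seq l <- [seq p - q | p <- W, q <- W] | l != 0])
  hsep hnp (filter_all _ _) measurableT T0.
(* This is the image of [B] under U^m, written as a preimage so that measurability and invariance
   apply directly. *)
pose V m := mpt_act U (- m) @^-1` B.
have mV m : measurable (V m) by exact: measurable_act_preimage.
have muV m : mu (V m) = mu B by have [_ ->] := mpt_act_preserving U (- m).
have tV : trivIset [set` W] V.
  move=> p q /= pW qW [w [Bp Bq]]; apply: contrapT => /eqP pq.
  have : (p - q) \in [seq l <- [seq p - q | p <- W, q <- W] | l != 0].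
    by rewrite mem_filter subr_eq0 pq; apply/allpairsP; exists (p, q).
  (* The point U^(-p) w of [B] is sent by U^(p-q) to U^(-q) w, again in [B]. *)
  move=> /hB; rewrite -subset0; apply; split; first exact: Bp.
  by rewrite /= -mpt_actD // addrAC subrr sub0r.
have bE : mu B = (fine (mu B))%:E by rewrite fineK // fin_num_measure.
set b := fine (mu B) in bE.
have b0 : 0 < b by rewrite -lte_fin -bE.
have muU (X' : {fset 'rV[int]_n}) : (X' `<=` W)%fset ->
    mu (\bigcup_(m in [set` X']) V m) = (#|` X'|%:R * b)%:E.
  move=> /fsubsetP XW; rewrite measure_fin_bigcup //.
  - rewrite (eq_fsbigr (fun=> b%:E)); last by move=> m _; exact: etrans (muV m) bE.
    rewrite fsbig_finite ?set_fsetK //= sumEFin.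
    by rewrite big_const_seq count_predT iter_addr_0 mulr_natl.
  - by apply: sub_trivIset tV => m /= /XW.
pose E' := \bigcup_(m in [set` fset_set E]) V m.
have mE' : measurable E' by apply: fin_bigcup_measurable.
have muE' : mu E' = (k%:R * b)%:E by apply: muU; exact: fsubsetUl.
have sub : \bigcup_(m in [set` X]) V m `<=`
    [set w | (alpha%:E < ergodic_strong_max U \1_E' w)%E].
  (* For w in [V h], the point U^j w lies in [V (h + j)]; thus the orbit of w visits [E'] whenever h
     + j is in [E], and the same [L] works. *)
  move=> w [h /XH Hh Vh]; move: Hh => /strong_sup_gtP [L rL Lh].
  apply/strong_sup_gtP; exists L => //; apply: lt_le_trans Lh _.
  apply: fset_avg_indic_le => j jL Ehj; exists (h + j).
    by rewrite /= in_fset_set // mem_set.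
  by rewrite /V /= -mpt_actD // opprD addrNK.
have CE' : ((mu E')^-1 * mu [set w | (alpha%:E < ergodic_strong_max U \1_E' w)%E] <= C)%E.
  apply: ereal_sup_ubound; exists E' => //; split=> //.
  by rewrite muE' lte_fin mulr_gt0.
rewrite muE' inver gt_eqF ?mulr_gt0 // lee_pdivrMl ?mulr_gt0 // in CE'.
(* Multiplying by [b], the measure of [B], turns both cardinalities into measures of unions of
   translates. *)
rewrite -(@lee_pmul2l _ b%:E) // -EFinM muleA -EFinM mulrC [b * _]mulrC.
rewrite -muU ?fsubsetUr //; apply: le_trans CE'; apply: le_measure => //.
- by rewrite inE; apply: fin_bigcup_measurable.
- by rewrite inE; exact: measurable_ergodic_superlevel.
Qed.

(** * Upper bound for the ergodic constant: transference along orbits *)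

Definition visits (Y : {fset 'rV[int]_n}) (A : set T) (w : T) : {fset 'rV[int]_n} :=
  [fset j in Y | mpt_act U j w \in A]%fset.

Lemma card_visits Y A w :
  #|` visits Y A w|%:R%:E = (\sum_(j <- Y) (\1_(mpt_act U j @^-1` A) w)%:E)%E :> \bar R.
Proof.
rewrite sumEFin card_fset_sum1 -big_fset_condE big_mkcond /= natr_sum.
by congr (_%:E); apply: eq_bigr => j _; rewrite indicE; case: (_ \in _).
Qed.

Lemma measurable_card_visits Y A : measurable A ->
  measurable_fun setT (fun w => #|` visits Y A w|%:R%:E : \bar R).
Proof.
move=> mA; under eq_fun do rewrite card_visits.
apply: emeasurable_sum => j; apply/measurable_EFinP; apply: measurable_indic.
exact: measurable_act_preimage.
Qed.

(** By invariance each time in [Y] contributes the same mass [mu A]. *)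
Lemma integral_card_visits Y A : measurable A ->
  (\int[mu]_w #|` visits Y A w|%:R%:E)%E = (#|` Y|%:R%:E * mu A)%E.
Proof.
move=> mA; under eq_integral do rewrite card_visits.
rewrite ge0_integral_sum //; last first.
  move=> j; apply/measurable_EFinP; apply: measurable_indic.
  exact: measurable_act_preimage.
have aE : mu A = (fine (mu A))%:E by rewrite fineK // fin_num_measure.
set a := fine (mu A) in aE.
rewrite aE (eq_bigr (fun=> a%:E)) => [|j _]; last first.
  rewrite integral_indic ?setIT //; last exact: measurable_act_preimage.
  by have [_ h] := mpt_act_preserving U j; exact: etrans (h _ mA) aE.
by rewrite sumEFin big_const_seq count_predT iter_addr_0 -EFinM mulr_natl.
Qed.

(** With this truncation, whether U^m w belongs to the set depends only on the visits to [E] at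
    times in m + [-N, N]^n. *)
Definition cube_superlevel (E : set T) (N : nat) : set T :=
  \bigcup_(L in [set L | lattice_rect R L /\ (L `<=` cube n N)%fset])
    avg_superlevel U alpha E L.

Lemma measurable_cube_superlevel E N : measurable E -> measurable (cube_superlevel E N).
Proof.
by move=> mE; apply: measurable_bigcup_fset => L; exact: measurable_avg_superlevel.
Qed.

(** For m in [cube n K], the shifted rectangle m + L stays in [cube n (K + N)], so the recorded
    visits to [E] determine its average and the finite Tauberian inequality applies. *)
Lemma card_visits_cube_superlevel (c : R) E N K w :
  commuting U -> 0 < alpha -> discrete_tauberian n alpha = c%:E ->
  #|` visits (cube n K) (cube_superlevel E N) w|%:R <=
  c * #|` visits (cube n (K + N)) E w|%:R.
Proof.
move=> hcomm alpha0 cE; apply: (discrete_tauberian_fset_le alpha0 cE) => m.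
rewrite !inE => /andP[mK /set_mem[L [rL /fsubsetP LN] Lm]]; exists L => //.
apply: lt_le_trans Lm _; apply: fset_avg_indic_le => j /LN jN Ej /=.
by rewrite !inE cubeD //= addrC mpt_actD // mem_set.
Qed.

Lemma ergodic_tauberian_le_discrete : commuting U -> 0 < alpha ->
  (ergodic_tauberian U alpha <= discrete_tauberian n alpha)%E.
Proof.
move=> hcomm alpha0.
(* Nonnegativity, tested on a singleton, excludes -oo; as +oo is trivial, a real constant [c]
   remains. *)
have : (0 <= discrete_tauberian n alpha :> \bar R)%E.
  apply: le_ereal_sup_tmp.
  pose z : 'rV[int]_n := 0.
  exists ((counting [set z])^-1 *
    counting [set m | alpha%:E < discrete_strong_max \1_[set z] m])%E.
    by exists [set z] => //; split; [exact: finite_set1 | exists z].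
  have ge0 (A : set 'rV[int]_n) : (0 <= counting A :> \bar R)%E.
    by rewrite /counting; case: ifP => _; rewrite ?leey // lee_fin.
  by rewrite mule_ge0 ?inve_ge0.
case cE : (discrete_tauberian n alpha) => [c| |] //; last by move=> _; rewrite leey.
rewrite lee_fin => c0; apply: ge_ereal_sup => _ [E [mE E0] <-].
have eE : mu E = (fine (mu E))%:E by rewrite fineK // fin_num_measure.
set e := fine (mu E) in eE.
have e0 : 0 < e by rewrite -lte_fin -eE.
rewrite eE inver gt_eqF // lee_pdivrMl //.
have mA N := measurable_cube_superlevel N mE.
have AN N : (mu (cube_superlevel E N) <= (e * c)%:E)%E.
  have aE : mu (cube_superlevel E N) = (fine (mu (cube_superlevel E N)))%:E.
    by rewrite fineK // fin_num_measure.
  (* The bound for each [K] is the pointwise inequality between visit counts, integrated over the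
     space. *)
  rewrite aE lee_fin; apply: (@le_of_cube_growth n _ _ _ N).
    by rewrite mulr_ge0 // ltW.
  move=> K; rewrite -lee_fin EFinM -aE -integral_card_visits // mulrCA mulrA.
  rewrite EFinM mulrC EFinM -eE.
  rewrite -integral_card_visits // muleC -ge0_integralZl_EFin //; last first.
    exact: measurable_card_visits.
  apply: ge0_le_integral => //.
  - exact: measurable_card_visits.
  - by apply: measurable_funeM; exact: measurable_card_visits.
  - by move=> w _; rewrite -EFinM lee_fin; exact: card_visits_cube_superlevel.
have -> : [set w | (alpha%:E < ergodic_strong_max U \1_E w)%E] =
    \bigcup_N cube_superlevel E N.
  rewrite ergodic_superlevelE; apply/seteqP; split=> w.
    by move=> [L rL Lw]; have [N LN] := fset_sub_cube L; exists N => //; exists L.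
  by move=> [N _ [L [rL _] Lw]]; exists L.
(* Every trace lies in some cube, so the truncated sets increase to the full superlevel set and
   continuity from below carries the uniform bound over. *)
have cv : (mu \o cube_superlevel E) N @[N --> \oo] --> mu (\bigcup_N cube_superlevel E N).
  apply: nondecreasing_cvg_mu => //; first exact: bigcup_measurable.
  move=> N M NM; apply/subsetPset => w [L [rL LN] Lw]; exists L => //; split=> //.
  exact: fsubset_trans LN (cube_homo n NM).
rewrite -(cvg_lim _ cv) //; apply: lime_le; first by apply/cvg_ex; eexists; exact: cv.
exact: nearW.
Qed.

End Comparison.

Theorem lemma3 (R : realType) (d : measure_display) (Omega : measurableType d)
    (mu : probability Omega R) (n : nat) (U : 'I_n -> mp_transf mu) (alpha : R)
    (hn : (0 < n)%N)
    (hsep : countably_separated mu)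
    (hna : non_atomic mu)
    (hcomm : commuting U)
    (hnp : non_periodic U)
    (halpha : 0 < alpha < 1) :
  ergodic_tauberian U alpha = discrete_tauberian n alpha.
Proof.
have /andP[alpha0 _] := halpha.
apply/eqP; rewrite eq_le; apply/andP; split.
- exact: ergodic_tauberian_le_discrete.
- exact: discrete_tauberian_le_ergodic.
Qed.
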